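(* Let $p$ be an odd prime and let $\lambda\in\mathbb{C}_p$ with $|\lambda|_p<p^{-\frac{1}{p-1}}$, $\lambda\neq0$. For every integer $n\ge0$ and every $x\in\mathbb{C}_p$ with $x\notin\{0,\lambda,2\lambda,\dots,(n-1)\lambda\}$, $$\mathcal{E}_{n,\lambda}(1-x)=(1-x)_{n,\lambda}+\sum_{l=1}^{n}B_{l,n}(x|\lambda)\,\mathcal{E}_{l,\lambda}\,\frac{(-\lambda)^{1-l}}{(l-1)!}\sum_{k=0}^{l-1}(-1)^k\binom{l-1}{k}\frac{1}{x-k\lambda}.$$
   Context: $\mathbb{C}_p$ is the completion of the algebraic closure of $\mathbb{Q}_p$, with $|p|_p=1/p$. For $x\in\mathbb{C}_p$ define $(x)_{0,\lambda}=1$ and $(x)_{n,\lambda}=x(x-\lambda)\cdots(x-(n-1)\lambda)$ for $n\ge1$. The degenerate Euler polynomials are defined by $\frac{2}{(1+\lambda t)^{1/\lambda}+1}(1+\lambda t)^{x/\lambda}=\sum_{n\ge0}\mathcal{E}_{n,\lambda}(x)\frac{t^n}{n!}$, and $\mathcal{E}_{n,\lambda}=\mathcal{E}_{n,\lambda}(0)$. The degenerate Bernstein polynomials are $B_{k,n}(x|\lambda)=\binom{n}{k}(x)_{k,\lambda}(1-x)_{n-k,\lambda}$ for integers $n\ge k\ge0$, and $B_{k,n}(x|\lambda)=0$ if $n<k$. *)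

(* Defs.v *)
From HB Require Import structures.
From mathcomp Require Import all_boot all_order all_algebra.
From mathcomp Require Import all_classical all_reals all_analysis.

Set Implicit Arguments.
Unset Strict Implicit.
Unset Printing Implicit Defensive.

Import Order.TTheory GRing.Theory Num.Theory.
Local Open Scope classical_set_scope.
Local Open Scope ring_scope.

(* mathcomp's norms do not fit here: the axiom [`|x *+ n| = `|x| *+ n] of
   normedZmodType excludes p-adic absolute values. *)
Record absolute_value (R : realType) (K : fieldType) := AbsoluteValue {
  absv :> K -> R;
  absv_ge0 : forall x, 0 <= absv x;
  absv_eq0 : forall x, (absv x == 0) = (x == 0);
  absvM : forall x y, absv (x * y) = absv x * absv y;
  ler_absvD : forall x y, absv (x + y) <= absv x + absv y
}.

(* A copy of [K] whose only structure is the metric [v (x - y)]. *)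
Definition metric_of (R : realType) (K : fieldType) (v : absolute_value R K) :
  Type := K.

Section MetricOf.
Variables (R : realType) (K : fieldType) (v : absolute_value R K).
Implicit Types x y z : K.

Let dist x y : R := v (x - y).

Lemma absvN x : v (- x) = v x.
Proof.
apply: (@pexpIrn _ 2); rewrite ?nnegrE ?absv_ge0 //.
by rewrite !expr2 -!absvM mulrNN.
Qed.

Let distxx x : dist x x = 0.
Proof. by apply/eqP; rewrite absv_eq0 subrr. Qed.

Let dist_positivity x y : dist x y = 0 -> x = y.
Proof. by move/eqP; rewrite absv_eq0 subr_eq0 => /eqP. Qed.

Let dist_sym x y : dist x y = dist y x.
Proof. by rewrite /dist -absvN opprB. Qed.

Let dist_triangle y x z : dist x z <= dist x y + dist y z.
Proof. by rewrite /dist -[x - z](subrKA y) ler_absvD. Qed.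

HB.instance Definition _ := Choice.copy (metric_of v) K.
HB.instance Definition _ := isPointed.Build (metric_of v) (0 : K).
HB.instance Definition _ := isMetric.Build R (metric_of v)
  distxx dist_positivity dist_sym dist_triangle.

Definition absv_complete : Prop :=
  forall F : set_system (metric_of v), ProperFilter F -> cauchy F -> cvg F.

Definition absv_dense (A : set K) : Prop := dense (A : set (metric_of v)).

End MetricOf.

Definition rat_padic_abs (R : realType) (p : nat) (q : rat) : R :=
  if q == 0 then 0
  else p%:R ^ ((logn p `|denq q|%N)%:Z - (logn p `|numq q|%N)%:Z).

Definition is_Qp (R : realType) (p : nat) (Q : fieldType)
    (v : absolute_value R Q) : Prop :=
  [/\ forall q : rat, v (ratr q) = rat_padic_abs R p q,
      absv_complete v & absv_dense v (range (ratr : rat -> Q))].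

(* [E] is an algebraic closure of [F] through [i], and [w] extends [v]. *)
Definition is_valued_alg_closure (R : realType) (F E : fieldType)
    (v : absolute_value R F) (w : absolute_value R E) (i : {rmorphism F -> E}) :
    Prop :=
  [/\ GRing.closed_field_axiom E,
      forall x : E, algebraicOver i x &
      forall x : F, w (i x) = v x].

Definition is_valued_completion (R : realType) (F C : fieldType)
    (v : absolute_value R F) (w : absolute_value R C) (j : {rmorphism F -> C}) :
    Prop :=
  [/\ forall x : F, w (j x) = v x, absv_complete w & absv_dense w (range j)].

(* Each step determines its field, with its absolute value, up to isometric
   isomorphism over the preceding one, so these conditions determine [C_p]. *)
Definition is_Cp (R : realType) (p : nat) (C : fieldType)
    (v : absolute_value R C) : Prop :=
  exists (Q Qbar : fieldType) (vQ : absolute_value R Q)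
         (vQbar : absolute_value R Qbar)
         (i : {rmorphism Q -> Qbar}) (j : {rmorphism Qbar -> C}),
    [/\ is_Qp p vQ, is_valued_alg_closure vQ vQbar i &
        is_valued_completion vQbar v j].

(* Formal power series are given by their coefficient sequences. *)
Section PowerSeries.
Variable K : fieldType.
Implicit Types f g : nat -> K.

Definition fps_const (c : K) : nat -> K := fun n => if n is 0%N then c else 0.

Definition fps_add f g : nat -> K := fun n => f n + g n.

Definition fps_mul f g : nat -> K := fun n => \sum_(i < n.+1) f i * g (n - i)%N.

(* The first [n] coefficients of [f / g], solving
   [f m = \sum_(i <= m) q i * g (m - i)] for [q m]. *)
Fixpoint fps_div_prefix f g (n : nat) : seq K :=
  if n is m.+1 then
    let q := fps_div_prefix f g m in
    rcons q ((f m - \sum_(i < m) q`_i * g (m - i)%N) / g 0%N)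
  else [::].

Definition fps_div f g : nat -> K := fun n => (fps_div_prefix f g n.+1)`_n.

Lemma size_fps_div_prefix f g n : size (fps_div_prefix f g n) = n.
Proof. by elim: n => //= n IHn; rewrite size_rcons IHn. Qed.

Lemma nth_fps_div_prefix f g n i :
  (i < n)%N -> (fps_div_prefix f g n)`_i = fps_div f g i.
Proof.
elim: n => // n IHn; rewrite ltnS leq_eqVlt => /predU1P[-> //|lt_in].
by rewrite [LHS]/= nth_rcons size_fps_div_prefix lt_in IHn.
Qed.

Lemma fps_divK f g : g 0%N != 0 -> fps_mul (fps_div f g) g = f.
Proof.
move=> g0; apply/funext => n; rewrite /fps_mul big_ord_recr /= subnn.
rewrite [fps_div f g n]/fps_div /= nth_rcons size_fps_div_prefix ltnn eqxx.
rewrite divfK //; under eq_bigr do rewrite -(@nth_fps_div_prefix _ _ n) //.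
by rewrite addrC subrK.
Qed.

(* The binomial series of [(1 + c t) ^ a]. *)
Definition binomial_series (c a : K) : nat -> K :=
  fun n => (\prod_(i < n) (a - i%:R)) / n`!%:R * c ^+ n.

End PowerSeries.

Definition deg_ffact (K : fieldType) (lambda x : K) (n : nat) : K :=
  \prod_(i < n) (x - i%:R * lambda).

Definition deg_euler (K : fieldType) (lambda : K) (n : nat) (x : K) : K :=
  n`!%:R *
  fps_mul
    (fps_div (fps_const 2%:R)
             (fps_add (binomial_series lambda (1 / lambda)) (fps_const 1)))
    (binomial_series lambda (x / lambda)) n.

Definition deg_euler_number (K : fieldType) (lambda : K) (n : nat) : K :=
  deg_euler lambda n 0.

Definition deg_bernstein (K : fieldType) (lambda : K) (k n : nat) (x : K) : K :=
  if (k <= n)%N then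
    'C(n, k)%:R * deg_ffact lambda x k * deg_ffact lambda (1 - x) (n - k)
  else 0.

(* Main.v *)
(** Multiplying the generating function of the degenerate Euler numbers by
    [(1 + lambda t) ^ (y / lambda)] gives [E_n(y) = \sum_l C(n, l) E_l (y)_(n-l)].
    At [y = 1 - x] the term [l = 0] is [(1 - x)_n] because [E_0 = 1], and for
    [l > 0] the partial fraction expansion of [1 / (x)_l] shows that the factor
    following [B_(l,n)(x) E_l] in the theorem is [1 / (x)_l].  The only property
    of [C_p] that matters is that its characteristic is zero. *)
Require Import Defs.
From mathcomp Require Import all_boot all_order all_algebra.
From mathcomp Require Import all_classical all_reals all_analysis.
From mathcomp Require Import ring.

Import Order.TTheory GRing.Theory Num.Theory.

Local Open Scope ring_scope.

Section PartialFractions.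
Variable K : fieldType.
Implicit Types (lambda x : K) (f : nat -> K).

(** Pascal's rule splits the sum in two: a finite difference of order [m.+1] is one of order [m]
    applied to the first difference of [f]. *)
Lemma sum_sign_binS f m :
  \sum_(k < m.+2) (-1) ^+ k * 'C(m.+1, k)%:R * f k =
  \sum_(k < m.+1) (-1) ^+ k * 'C(m, k)%:R * (f k - f k.+1).
Proof.
transitivity (\sum_(k < m.+2) (-1) ^+ k * 'C(m, k)%:R * f k
  - \sum_(k < m.+1) (-1) ^+ k * 'C(m, k)%:R * f k.+1).
  rewrite big_ord_recl [in RHS]big_ord_recl !bin0 -addrA; congr (_ + _).
  rewrite -sumrB; apply: eq_bigr => k _.
  by rewrite lift0 binS natrD exprS; ring.
(* The extra top term carries ['C(m, m.+1) = 0]. *)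
rewrite big_ord_recr /= bin_small // mulr0 mul0r addr0 -sumrB.
by apply: eq_bigr => k _; rewrite mulrBr.
Qed.

Lemma deg_ffactSl lambda x n :
  deg_ffact lambda x n.+1 = x * deg_ffact lambda (x - lambda) n.
Proof.
rewrite /deg_ffact big_ord_recl mul0r subr0; congr (_ * _).
by apply: eq_bigr => i _; rewrite lift0 -natr1; ring.
Qed.

Lemma deg_ffactSr lambda x n :
  deg_ffact lambda x n.+1 = deg_ffact lambda x n * (x - n%:R * lambda).
Proof. by rewrite /deg_ffact big_ord_recr. Qed.

(** Up to sign, the left side is the [m]-th finite difference of [1 / x] with step [lambda]. By
    induction it is a difference of two values of the formula, at [x] and at [x - lambda]. *)
Lemma sum_sign_bin_inv lambda x m :
    deg_ffact lambda x m.+1 != 0 ->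
  \sum_(k < m.+1) (-1) ^+ k * 'C(m, k)%:R * (1 / (x - k%:R * lambda)) =
  (- lambda) ^+ m * m`!%:R / deg_ffact lambda x m.+1.
Proof.
elim: m x => [|m IHm] x x_neq0.
  by rewrite big_ord1 deg_ffactSr /deg_ffact big_ord0 bin0 fact0 !mul1r.
rewrite (sum_sign_binS (fun k => 1 / (x - k%:R * lambda))).
under eq_bigr do rewrite mulrBr.
have shiftE k : x - k.+1%:R * lambda = x - lambda - k%:R * lambda.
  by rewrite -natr1; ring.
rewrite sumrB; under [X in _ - X]eq_bigr do rewrite shiftE.
(* Both denominators share the factor [deg_ffact lambda (x - lambda) m]; the remaining factors, [x]
   and [x - lambda - m%:R * lambda], differ by [m.+1%:R * lambda], which supplies the next factors
   of the power and of the factorial. *)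
move: x_neq0; rewrite deg_ffactSl deg_ffactSr !mulf_eq0 !negb_or.
move=> /andP[x0 /andP[P0 last0]].
rewrite !IHm; [|by rewrite deg_ffactSr mulf_neq0|by rewrite deg_ffactSl mulf_neq0].
rewrite (deg_ffactSl _ x) deg_ffactSr factS natrM exprS -natr1.
by field; rewrite last0 P0 x0.
Qed.

End PartialFractions.

Section DegenerateEuler.
Variables (K : fieldType) (lambda : K).
Hypotheses (lambda_neq0 : lambda != 0) (natK : forall n, n.+1%:R != 0 :> K).

Let fact_neq0 n : n`!%:R != 0 :> K.
Proof. by rewrite -(prednK (fact_gt0 n)). Qed.

(** Each of the [n] factors [y / lambda - i%:R] absorbs one [lambda] of [lambda ^+ n]. *)
Lemma binomial_series_deg_ffact y n :
  binomial_series lambda (y / lambda) n = deg_ffact lambda y n / n`!%:R.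
Proof.
rewrite /binomial_series /deg_ffact mulrAC; congr (_ / _).
rewrite -[in lambda ^+ n](card_ord n) -prodr_const -big_split /=.
by apply: eq_bigr => i _; rewrite mulrBl divfK.
Qed.

Let euler_series := fps_div (fps_const 2%:R)
  (fps_add (binomial_series lambda (1 / lambda)) (fps_const 1)).

Lemma deg_ffact0n n : deg_ffact lambda 0 n = (n == 0%N)%:R :> K.
Proof.
by case: n => [|n]; rewrite ?deg_ffactSl ?mul0r // /deg_ffact big_ord0.
Qed.

(** At argument 0 the second series of the product is the constant 1. *)
Lemma deg_euler_numberE n : deg_euler_number lambda n = n`!%:R * euler_series n.
Proof.
rewrite /deg_euler_number /deg_euler /fps_mul big_ord_recr /= subnn.
rewrite binomial_series_deg_ffact deg_ffact0n divr1 mulr1 big1 ?add0r // => i _.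
by rewrite binomial_series_deg_ffact deg_ffact0n subn_eq0 leqNgt ltn_ord mul0r mulr0.
Qed.

Lemma deg_euler_number0 : deg_euler_number lambda 0 = 1.
Proof.
rewrite deg_euler_numberE fact0 mul1r /euler_series /fps_div /= big_ord0 subr0.
rewrite /fps_add /= /binomial_series big_ord0 expr0 mulr1 divr1 -natr1.
by rewrite divff // (natK 1).
Qed.

Lemma deg_eulerE n y : deg_euler lambda n y =
  \sum_(l < n.+1)
    'C(n, l)%:R * deg_euler_number lambda l * deg_ffact lambda y (n - l).
Proof.
rewrite /deg_euler /fps_mul mulr_sumr; apply: eq_bigr => l _.
rewrite deg_euler_numberE binomial_series_deg_ffact -/euler_series.
have le_ln : (l <= n)%N by rewrite -ltnS.
(* Writing [n!] as ['C(n, l) * (l! * (n - l)!)] cancels the factorials of both series. *)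
rewrite -(bin_fact le_ln) !natrM.
by field; apply: fact_neq0.
Qed.

End DegenerateEuler.

(** Field morphisms are injective, so the claim descends to [Q], where a nonzero integer has a power
    of [p] as absolute value. *)
Lemma is_Cp_natr_neq0 (R : realType) (p : nat) (Cp : fieldType)
    (absCp : absolute_value R Cp) :
  prime p -> is_Cp p absCp -> forall n, n.+1%:R != 0 :> Cp.
Proof.
move=> p_pr [Q [Qbar [vQ [vQbar [i [j [[vQE _ _] _ _]]]]]]] n.
rewrite -(rmorph_nat j) fmorph_eq0 -(rmorph_nat i) fmorph_eq0.
have -> : n.+1%:R = ratr n.+1%:R :> Q.
  by rewrite [in RHS]pmulrn /ratr numq_int denq_int divr1.
rewrite -(absv_eq0 vQ) vQE /rat_padic_abs pnatr_eq0 /=.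
by rewrite expfz_neq0 // pnatr_eq0 -lt0n prime_gt0.
Qed.

Theorem theorem2p4 (R : realType) (p : nat) (Cp : fieldType)
    (absCp : absolute_value R Cp)
    (p_prime : prime p) (p_odd : odd p) (Cp_p : is_Cp p absCp)
    (lambda : Cp)
    (lambda_small : absCp lambda < (p%:R : R) `^ (- (1 / (p%:R - 1))))
    (lambda_neq0 : lambda <> 0)
    (n : nat) (x : Cp)
    (x_notin : forall i : nat, (i < n)%N -> x <> i%:R * lambda) :
  deg_euler lambda n (1 - x) =
    deg_ffact lambda (1 - x) n +
    \sum_(1 <= l < n.+1)
      deg_bernstein lambda l n x * deg_euler_number lambda l *
      ((- lambda) ^ (1 - l%:Z) / (l.-1)`!%:R) *
      \sum_(0 <= k < l) (-1) ^+ k * 'C(l.-1, k)%:R * (1 / (x - k%:R * lambda)).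
Proof.
have natC := is_Cp_natr_neq0 _ _ _ _ p_prime Cp_p.
have lam0 : lambda != 0 by apply/eqP.
rewrite deg_eulerE // big_ord_recl bin0 subn0 deg_euler_number0 // !mul1r.
congr (_ + _); rewrite big_add1 /= big_mkord; apply: eq_bigr => l _.
have lt_ln := ltn_ord l.
(* The index is now shifted by one: [l.+1 <= n], so every root of this product is among the excluded
   values of [x]. *)
have ffact0 : deg_ffact lambda x l.+1 != 0.
  apply/prodf_neq0 => i _; rewrite subr_eq0; apply/eqP/x_notin.
  exact: leq_trans (ltn_ord i) lt_ln.
rewrite big_mkord sum_sign_bin_inv // /deg_bernstein /bump /= add1n lt_ln.
(* The prefactor thus cancels the power and the factorial produced by the alternating sum. *)
have -> : 1 - l.+1%:Z = - l%:Z by rewrite intS; ring.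
rewrite -exprnN.
have lf0 : l`!%:R != 0 :> Cp by rewrite -(prednK (fact_gt0 l)).
have lamX0 : (- lambda) ^+ l != 0 by rewrite expf_neq0 // oppr_eq0.
by field; rewrite ffact0 lf0 lamX0.
Qed.
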